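(* For any integers $k\ge 1$ and $n\ge 3$ there exists a (minimal) positive integer $U_k(n)$ such that the following holds for any $k$-crossing system of paths $S$ of size at least $U_k(n)$: (1) If $k\le 2$ and every subsystem of $S$ of size $3$ is upper convex, then $S$ contains an upper convex subsystem of size $n$. (2) If $k\le 4$ and every subsystem of $S$ of size $4$ is upper convex, then $S$ contains an upper convex subsystem of size $n$. (3) If $k\ge 5$ and every subsystem of $S$ of size $5$ is upper convex, then $S$ contains an upper convex subsystem of size $n$.
   Context: A path is the graph of a continuous function $f:[0,1]\to\mathbb{R}$. A system of paths is a finite collection of at least three paths such that: the paths have distinct endpoints (the left endpoints are pairwise distinct and the right endpoints are pairwise distinct); any two paths intersect in finitely many points; no two paths are tangent, i.e. paths cross at every point where they intersect; no three paths have a common point. A system is $k$-crossing if each pair of its paths crosses at least $1$ time and at most $k$ times. The size of a system is its number of paths; a subsystem is a subset of at least three of its paths. A path belongs to the upper envelope of a system if for some $t\in[0,1]$ it lies strictly above every other path of the system at $t$. A system is upper convex if all of its paths belong to its upper envelope. *)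

(* Defs.v *)
From mathcomp Require Import all_boot all_order all_algebra.
From mathcomp Require Import all_classical all_reals all_analysis.
Set Implicit Arguments.
Unset Strict Implicit.
Unset Printing Implicit Defensive.
Import Order.TTheory GRing.Theory Num.Theory.
Import numFieldNormedType.Exports.
Local Open Scope classical_set_scope.
Local Open Scope card_scope.
Local Open Scope ring_scope.

(* A path, i.e. the graph of a continuous function on [0, 1], is represented  *)
(* by a total function R -> R whose values outside [0, 1] are never used.     *)
Definition is_path (R : realType) (f : R -> R) : Prop :=
  {within `[0, 1], continuous f}.

Definition intersections (R : realType) (f g : R -> R) : set R :=
  [set t | t \in `[0, 1] /\ f t = g t].

(* Restricting t to ]0, 1[ makes both one-sided neighbourhoods meaningful; it *)
(* loses nothing, since paths of a system never meet at 0 or 1.               *)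
Definition crosses_at (R : realType) (f g : R -> R) (t : R) : Prop :=
  [/\ t \in `]0, 1[, f t = g t &
      ((\forall s \near t^'-, f s < g s) /\ (\forall s \near t^'+, g s < f s))
   \/ ((\forall s \near t^'-, g s < f s) /\ (\forall s \near t^'+, f s < g s))].

Definition crossings (R : realType) (f g : R -> R) : set R :=
  [set t | crosses_at f g t].

(* The members of a system are indexed by 'I_m; the indexing is injective     *)
(* because the endpoints are distinct, so m is the size of the system.        *)
Record path_system (R : realType) (m : nat) (p : 'I_m -> R -> R) : Prop :=
  PathSystem {
    system_size : (3 <= m)%N ;
    system_path : forall i, is_path (p i) ;
    system_left : injective (fun i => p i 0) ;
    system_right : injective (fun i => p i 1) ;
    system_finite :
      forall i j, i != j -> finite_set (intersections (p i) (p j)) ;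
    system_cross : forall i j, i != j ->
      forall t, intersections (p i) (p j) t -> crosses_at (p i) (p j) t ;
    system_triple : forall i j l, i != j -> i != l -> j != l ->
      forall t, t \in `[0, 1] -> ~ (p i t = p j t /\ p j t = p l t)
  }.

Definition k_crossing (R : realType) (k m : nat) (p : 'I_m -> R -> R) : Prop :=
  forall i j, i != j ->
    (`I_1 #<= crossings (p i) (p j)) /\ (crossings (p i) (p j) #<= `I_k).

(* Subsystems are given by their set A of indices. *)
Definition in_upper_envelope (R : realType) (m : nat) (p : 'I_m -> R -> R)
    (A : {set 'I_m}) (i : 'I_m) : Prop :=
  exists2 t : R, t \in `[0, 1] & forall j, j \in A -> j != i -> p j t < p i t.

Definition upper_convex (R : realType) (m : nat) (p : 'I_m -> R -> R)
    (A : {set 'I_m}) : Prop :=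
  forall i, i \in A -> in_upper_envelope p A i.

(* The bound |A| >= 3 in the notion of subsystem is automatic in the next two  *)
(* definitions, which are only used with q >= 3 and n >= 3.                   *)
Definition all_subsystems_upper_convex (R : realType) (m : nat)
    (p : 'I_m -> R -> R) (q : nat) : Prop :=
  forall A : {set 'I_m}, #|A| = q -> upper_convex p A.

Definition has_upper_convex_subsystem (R : realType) (m : nat)
    (p : 'I_m -> R -> R) (n : nat) : Prop :=
  exists A : {set 'I_m}, #|A| = n /\ upper_convex p A.

(* U is an admissible (not necessarily minimal) value for U_k(n). *)
Definition upper_convex_bound (R : realType) (k n U : nat) : Prop :=
  forall (m : nat) (p : 'I_m -> R -> R),
    path_system p -> k_crossing k p -> (U <= m)%N ->
    [/\ (k <= 2)%N -> all_subsystems_upper_convex p 3 ->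
          has_upper_convex_subsystem p n,
        (k <= 4)%N -> all_subsystems_upper_convex p 4 ->
          has_upper_convex_subsystem p n &
        (5 <= k)%N -> all_subsystems_upper_convex p 5 ->
          has_upper_convex_subsystem p n].

(* Main.v *)
Require Import Defs.
From mathcomp Require Import all_boot all_order all_algebra.
From mathcomp Require Import all_classical all_reals all_analysis.
From mathcomp Require Import finmap lra zify.
Set Implicit Arguments.
Unset Strict Implicit.
Unset Printing Implicit Defensive.
Import Order.TTheory GRing.Theory Num.Theory.
Import numFieldNormedType.Exports.

(* Sort the paths by left endpoint. By Ramsey's theorem for triples there is a
   large subsystem in which all pairs cross the same number r of times and all
   triples have the same order type of crossing times. Path i is above path j
   during the gaps between consecutive crossings whose index is even if j < i and
   odd if i < j, and whether gap a of (i, j) overlaps gap b of (i, l) depends only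
   on a, b and the order of i, j, l. If the overlaps a, b hold for all j < l on the
   same side of i, then one of a, a or b, b does as well: otherwise two disjoint
   intervals would both overlap three disjoint ones. Hence upper convexity of all
   5-subsystems yields an even gap and an odd gap that pairwise overlap throughout
   the subsystem, and Helly's theorem on the line puts every path on the upper
   envelope. For r <= 2 the first or last gap can be used and pairs suffice. For
   r = 3, 4 upper convexity of 4-subsystems leaves a few exceptional patterns,
   which cannot be realized by four paths because no three paths are ever
   cyclically ordered. *)

(** * Ramsey's theorem *)

Lemma pigeonhole_count (C : finType) (T : Type) (g : T -> C) (s : seq T) n :
  #|C| * n < size s -> exists c, n <= count (fun x => g x == c) s.
Proof.
move=> h; apply/existsP; rewrite -[[exists c, _]]negbK negb_exists.
apply: contraL h => /forallP small; rewrite -leqNgt.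
have -> : size s = \sum_c count (fun x => g x == c) s.
  elim: s {small} => [|x s IH] /=; first by rewrite big1.
  rewrite big_split /= -IH (bigD1 (g x)) //= eqxx big1 ?addn0 // => c.
  by rewrite eq_sym => /negPf ->.
rewrite -sum_nat_const leq_sum // => c _.
by rewrite ltnW // ltnNge small.
Qed.

(** Induction on [a]. The induction hypothesis thins the tail behind each chosen head [x] until the
    colour of [x :: u] depends on [x] alone; pigeonhole then keeps heads of one colour. Subsequences
    instead of sets preserve the order of the paths. *)
Lemma ramsey (C : finType) (a n : nat) : exists N, forall (T : eqType)
    (col : seq T -> C) (s : seq T), N <= size s ->
  exists c s', [/\ subseq s' s, size s' = n &
    forall u, subseq u s' -> size u = a -> col u = c].
Proof.
elim: a n => [|a IHa] n.
  exists n => T col s ns; exists (col [::]), (take n s).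
  by rewrite take_subseq size_takel //; split => // u _ /size0nil ->.
(* End-homogeneous subsequences: [g x] is the common colour of all tuples that start at [x]. *)
have [N endP] : exists N, forall (T : eqType) (col : seq T -> C) (s : seq T),
    N <= size s -> exists (g : T -> C) s', [/\ subseq s' s, #|C| * n < size s' &
    forall x u, subseq (x :: u) s' -> size u = a -> col (x :: u) = g x].
  elim: (#|C| * n).+1 => [|M [N IHM]].
    exists 1 => T col [//|x s] _; exists (fun x => col [:: x]), [::].
    by split=> //; rewrite sub0seq.
  have [N' rP] := IHa N; exists N'.+1 => T col [//|x s] /= Ns.
  have [c [s1 [s1s N1 cP]]] := rP T (fun u => col (x :: u)) s Ns.
  have [|g [s2 [s21 N2 gP]]] := IHM T col s1; first by rewrite N1.
  exists (fun y => if y == x then c else g y), (x :: s2); split => //=.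
    by rewrite eqxx (subseq_trans s21).
  move=> y u; case: ifP => [/eqP -> us ua|_ us ua]; last exact: gP.
  by apply: cP => //; apply: subseq_trans us s21.
exists N => T col s Ns; have [g [s1 [s1s N1 gP]]] := endP T col s Ns.
have [c nc] := pigeonhole_count g N1.
pose s2 := [seq x <- s1 | g x == c].
have s21 : subseq s2 s1 by apply: filter_subseq.
exists c, (take n s2); split.
- exact: subseq_trans (take_subseq _ _) (subseq_trans s21 s1s).
- by rewrite size_takel // size_filter.
move=> [//|x u] us [ua]; have us2 := subseq_trans us (take_subseq _ _).
rewrite (gP x u (subseq_trans us2 s21) ua).
by have : x \in s2 by [rewrite (mem_subseq us2) ?mem_head]; rewrite mem_filter => /andP[/eqP].
Qed.

Local Open Scope classical_set_scope.
Local Open Scope ring_scope.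

(** * Homogeneous crossing patterns *)

Definition overlap (R : numDomainType) (u : nat -> R) a (v : nat -> R) b :=
  (u a < v b.+1) && (v b < u a.+1).

Definition triangle (I T : Type) (X : I -> I -> T) (i j l : I) (e : 'I_3) :=
  match val e with 0%N => X i j | 1%N => X i l | _ => X j l end.

(* [X i j a] is the a-th crossing time of paths i < j, for 1 <= a <= r; the
   sentinels -1 and 2 lie outside [0, 1], so that the extreme gaps contain the
   endpoints 0 and 1. *)
Record homogeneous (R : realFieldType) (N r : nat) (X : nat -> nat -> nat -> R) :
    Prop := Homogeneous {
  hom0 : forall i j, (i < j < N)%N -> X i j 0%N = -1;
  homS : forall i j, (i < j < N)%N -> X i j r.+1 = 2;
  hom_incr : forall i j a, (i < j < N)%N -> (a <= r)%N -> X i j a < X i j a.+1;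
  hom_itv : forall i j a, (i < j < N)%N -> (0 < a <= r)%N -> 0 < X i j a < 1;
  hom_neq : forall i j l a b, (i < j)%N -> (j < l < N)%N ->
    (0 < a <= r)%N -> (0 < b <= r)%N -> X i j a != X j l b;
  hom_acyclic : forall i j l a b c t, (i < j)%N -> (j < l < N)%N ->
    (a <= r)%N -> (b <= r)%N -> (c <= r)%N -> 0 <= t <= 1 ->
    X i j a < t < X i j a.+1 -> X j l b < t < X j l b.+1 ->
    X i l c < t < X i l c.+1 -> odd a = odd b -> odd c = odd a;
  hom_cmp : forall i j l i' j' l' e e' a b,
    (i < j)%N -> (j < l < N)%N -> (i' < j')%N -> (j' < l' < N)%N ->
    (a <= r.+1)%N -> (b <= r.+1)%N ->
    (triangle X i j l e a < triangle X i j l e' b) =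
    (triangle X i' j' l' e a < triangle X i' j' l' e' b) }.

(** * Intervals on the line *)

(* The middle one of three disjoint intervals, each meeting an interval A, is
   contained in A; hence it cannot be contained in two disjoint intervals. *)
Lemma two_three_intervals (R : realFieldType) (a1 a1' a2 a2' b1 b1' b2 b2' b3 b3' : R) :
  a1 < a1' -> a2 < a2' -> b1 < b1' -> b2 < b2' -> b3 < b3' ->
  a1' <= a2 \/ a2' <= a1 ->
  b1' <= b2 \/ b2' <= b1 -> b1' <= b3 \/ b3' <= b1 -> b2' <= b3 \/ b3' <= b2 ->
  a1 < b1' -> b1 < a1' -> a1 < b2' -> b2 < a1' -> a1 < b3' -> b3 < a1' ->
  a2 < b1' -> b1 < a2' -> a2 < b2' -> b2 < a2' -> a2 < b3' -> b3 < a2' -> False.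
Proof. by do 5 move=> ?; do 4 case=> ?; move=> *; lra. Qed.

Lemma seq_max (R : realDomainType) (s : seq R) (x : R) : x \in s ->
  exists2 m, m \in s & forall y, y \in s -> y <= m.
Proof.
elim: s x => // y [_|z s IH] x _.
  by exists y; rewrite ?mem_head // => z; rewrite inE => /eqP->.
have [m ms mP] := IH z (mem_head _ _).
have [ym|my] := leP y m.
  by exists m => [|u]; rewrite inE ?ms ?orbT // => /predU1P[->|/mP].
exists y => [|u]; rewrite inE ?eqxx // => /predU1P[->//|/mP um].
exact: le_trans um (ltW my).
Qed.

(** With left ends in [s1] and right ends in [s2], the midpoint of the largest left end and the
    smallest right end lies in all the intervals. *)
Lemma helly_intervals (R : realFieldType) (s1 s2 : seq R) (x1 x2 : R) :
  x1 \in s1 -> x2 \in s2 -> (forall u v, u \in s1 -> v \in s2 -> u < v) ->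
  exists t, (forall u, u \in s1 -> u < t) /\ (forall v, v \in s2 -> t < v).
Proof.
move=> x1s x2s h; have [m ms mP] := seq_max x1s.
(* The minimum of [s2], as the maximum of the opposites. *)
have [k] : exists2 k, k \in [seq - z | z <- s2] &
   forall y, y \in [seq - z | z <- s2] -> y <= k.
  by apply: (@seq_max _ _ (- x2)); rewrite map_f.
move=> /mapP[{}k ks ->] kP; have mk := h _ _ ms ks.
exists ((m + k) / 2); split => [u /mP um|v vs]; first by lra.
by have := kP _ (map_f _ vs); lra.
Qed.

Lemma exists_between (R : realFieldType) (u v : R) : u < v -> exists t, u < t /\ t < v.
Proof. by move=> uv; exists ((u + v) / 2); split; lra. Qed.

(** * Overlapping gaps in a homogeneous pattern *)

Section Homogeneous.
Variables (R : realFieldType) (N r : nat) (X : nat -> nat -> nat -> R).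
Hypothesis (N6 : (6 <= N)%N) (hX : homogeneous N r X).

(* Whether gap a of one pair overlaps gap b of another, when the common path is
   the lowest (ER), the middle (EM) or the highest (EL) of the three at time 0; by
   [hom_cmp] it suffices to test this on the paths 0, 1, 2. *)
Definition ER a b := overlap (X 0%N 1%N) a (X 0%N 2%N) b.
Definition EM a b := overlap (X 0%N 1%N) a (X 1%N 2%N) b.
Definition EL a b := overlap (X 0%N 2%N) a (X 1%N 2%N) b.

Lemma ERE i j l a b : (i < j)%N -> (j < l < N)%N -> (a <= r)%N -> (b <= r)%N ->
  overlap (X i j) a (X i l) b = ER a b.
Proof.
move=> ij jl ar br; rewrite /ER /overlap.
have h e e' a' b' := @hom_cmp _ _ _ _ hX i j l 0%N 1%N 2%N e e' a' b' ij jl.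
by congr andb; [apply: (h 0 1)|apply: (h 1 0)]; lia.
Qed.

Lemma EME i j l a b : (i < j)%N -> (j < l < N)%N -> (a <= r)%N -> (b <= r)%N ->
  overlap (X i j) a (X j l) b = EM a b.
Proof.
move=> ij jl ar br; rewrite /EM /overlap.
have h e e' a' b' := @hom_cmp _ _ _ _ hX i j l 0%N 1%N 2%N e e' a' b' ij jl.
by congr andb; [apply: (h 0 2%:R)|apply: (h 2%:R 0)]; lia.
Qed.

Lemma ELE i j l a b : (i < j)%N -> (j < l < N)%N -> (a <= r)%N -> (b <= r)%N ->
  overlap (X i l) a (X j l) b = EL a b.
Proof.
move=> ij jl ar br; rewrite /EL /overlap.
have h e e' a' b' := @hom_cmp _ _ _ _ hX i j l 0%N 1%N 2%N e e' a' b' ij jl.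
by congr andb; [apply: (h 1 2%:R)|apply: (h 2%:R 1)]; lia.
Qed.

Lemma overlapN (u v : nat -> R) a b : ~~ overlap u a v b -> v b.+1 <= u a \/ u a.+1 <= v b.
Proof. by rewrite negb_and -!leNgt => /orP. Qed.

Lemma overlap_two_three (u v : nat -> nat -> R) a b :
  (forall x, (x < 2)%N -> u x a < u x a.+1) ->
  (forall y, (y < 3)%N -> v y b < v y b.+1) ->
  (forall x y, (x < 2)%N -> (y < 3)%N -> overlap (u x) a (v y) b) ->
  ~~ overlap (u 0%N) a (u 1%N) a ->
  ~~ overlap (v 0%N) b (v 1%N) b -> ~~ overlap (v 0%N) b (v 2%N) b ->
  ~~ overlap (v 1%N) b (v 2%N) b -> False.
Proof.
move=> hu hv huv /overlapN a12 /overlapN b12 /overlapN b13 /overlapN b23.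
have {}huv x y : (x < 2)%N -> (y < 3)%N -> u x a < v y b.+1 /\ v y b < u x a.+1.
  by move=> x2 y3; apply/andP/huv.
have [? ?] := huv 0 0 isT isT; have [? ?] := huv 0 1 isT isT.
have [? ?] := huv 0 2 isT isT; have [? ?] := huv 1 0 isT isT.
have [? ?] := huv 1 1 isT isT; have [? ?] := huv 1 2 isT isT.
apply: (two_three_intervals (hu 0 isT) (hu 1 isT) (hv 0 isT) (hv 1 isT) (hv 2 isT)) => //;
  by rewrite or_comm.
Qed.

(** Otherwise the gaps [a] of (0, 1), (0, 2) would be disjoint, the gaps [b] of (0, 3), (0, 4), (0,
    5) pairwise disjoint, and each of the former would overlap each of the latter. This takes the
    six paths given by [N6]. *)
Lemma ER_refl a b : (a <= r)%N -> (b <= r)%N -> ER a b -> ER a a || ER b b.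
Proof.
move=> ar br ab; rewrite -[_ || _]negbK; apply/negP => /norP[aa bb].
apply: (@overlap_two_three (fun x => X 0%N x.+1) (fun y => X 0%N y.+3) a b).
all: intros; cbv beta; rewrite ?ERE //; try (apply: (hom_incr hX)); lia.
Qed.

Lemma EL_refl a b : (a <= r)%N -> (b <= r)%N -> EL a b -> EL a a || EL b b.
Proof.
move=> ar br ab; rewrite -[_ || _]negbK; apply/negP => /norP[aa bb].
apply: (@overlap_two_three (fun x => X x 5%N) (fun y => X y.+2 5%N) a b).
all: intros; cbv beta; rewrite ?ELE //; try (apply: (hom_incr hX)); lia.
Qed.

(** The same argument around path 2: gaps [a] of (0, 2), (1, 2) against gaps [b] of (2, 3), (2, 4),
    (2, 5). *)
Lemma EM_refl a b : (a <= r)%N -> (b <= r)%N -> EM a b -> EL a a || ER b b.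
Proof.
move=> ar br ab; rewrite -[_ || _]negbK; apply/negP => /norP[aa bb].
apply: (@overlap_two_three (fun x => X x 2%N) (fun y => X 2%N y.+3) a b).
all: intros; cbv beta; rewrite ?ELE ?ERE ?EME //; try (apply: (hom_incr hX)); lia.
Qed.

Lemma homS_gt0 i j a : (i < j < N)%N -> (a <= r)%N -> 0 < X i j a.+1.
Proof.
move=> ij; rewrite leq_eqVlt => /predU1P[->|ar]; first by rewrite (homS hX) ?ltr0n.
by have /andP[] := hom_itv hX ij (a := a.+1) ar.
Qed.

Lemma hom_lt1 i j a : (i < j < N)%N -> (a <= r)%N -> X i j a < 1.
Proof.
case: a => [|a] ij ar; first by rewrite (hom0 hX) //; lra.
by have /andP[] := hom_itv hX ij (a := a.+1) ar.
Qed.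

Definition points i j := if (i < j)%N then X i j else X j i.

(* [t] lies in the a-th gap between crossings of i and j, and the parity of [a]
   tells that path i is above path j there. *)
Definition component i j a t :=
  [&& (a <= r)%N, odd a == (i < j)%N & points i j a < t < points i j a.+1].

(** Helly's theorem on the gaps between [i] and all other paths. They overlap pairwise: two lower
    paths by [EL a a], two higher ones by [ER b b], one of each by [EM a b]. *)
Lemma common_component a b i : (a <= r)%N -> (b <= r)%N -> ~~ odd a -> odd b ->
  EL a a -> ER b b -> EM a b -> (i < N)%N ->
  exists2 t, 0 <= t <= 1 & forall j, (j < N)%N -> j != i ->
    component i j (if (j < i)%N then a else b) t.
Proof.
move=> ar br ea ob aa bb ab iN.
pose c j := if (j < i)%N then a else b.
have cr j : (c j <= r)%N by rewrite /c; case: ifP.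
pose J := [seq j <- iota 0 N | j != i].
have JP j : (j \in J) = (j != i) && (j < N)%N.
  by rewrite mem_filter mem_iota add0n.
have pointsP (P : (nat -> R) -> Prop) j : j \in J ->
    (forall h l, (h < l < N)%N -> P (X h l)) -> P (points i j).
  by rewrite JP /points => /andP[/eqP ji jN]; case: ltnP => ij; apply; lia.
have Ylt j l : j \in J -> l \in J -> points i j (c j) < points i l (c l).+1.
  move=> jJ lJ; have [<-|/eqP jl] := eqVneq j l.
    by apply: (pointsP (fun u => u (c j) < u (c j).+1) j jJ) => h k hk;
      apply: (hom_incr hX) (cr j).
  move: jJ lJ; rewrite !JP => /andP[/eqP ji jN] /andP[/eqP li lN].
  rewrite /points /c; have [ji'|ij|//] := ltngtP j i; have [li'|il|//] := ltngtP l i.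
  - have [jl'|lj] := ltnP j l.
      by move: aa; rewrite -(@ELE j l i) //; [case/andP|lia].
    by move: aa; rewrite -(@ELE l j i) //; [case/andP|lia|lia].
  - by move: ab; rewrite -(@EME j i l) //; [case/andP|lia].
  - by move: ab; rewrite -(@EME l i j) //; [case/andP|lia].
  - have [jl'|lj] := ltnP j l.
      by move: bb; rewrite -(@ERE i j l) //; [case/andP|lia].
    by move: bb; rewrite -(@ERE i l j) //; [case/andP|lia].
(* The extra interval from 0 to 1 keeps [t] in the domain of the paths. *)
have [|t [tl tr]] := @helly_intervals _ (0 :: [seq points i j (c j) | j <- J])
    (1 :: [seq points i j (c j).+1 | j <- J]) 0 1 (mem_head _ _) (mem_head _ _).
  move=> u v; rewrite !inE => /predU1P[->|/mapP[j jJ ->]] /predU1P[->|/mapP[l lJ ->]].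
  - exact: ltr01.
  - by apply: (pointsP (fun u => 0 < u (c l).+1) l lJ) => h k hk; apply: homS_gt0 (cr l).
  - by apply: (pointsP (fun u => u (c j) < 1) j jJ) => h k hk; apply: hom_lt1 (cr j).
  - exact: Ylt.
exists t; first by rewrite !ltW // ?tl ?tr ?mem_head.
move=> j jN ji; have jJ : j \in J by rewrite JP ji.
apply/and3P; split; first exact: cr.
- case: (ltngtP j i) => [||/eqP]; rewrite ?(negPf ea) ?ob //.
  by rewrite (negPf ji).
- by rewrite tl ?tr // inE (map_f _ jJ) orbT.
Qed.

(** * Impossible patterns with three or four crossings *)

Local Notation x i j a := (X i%N j%N a%N) (only parsing).

Lemma lt_pairs i j l : (i < j)%N -> (j < l < N)%N -> (i < j < N)%N /\ (i < l < N)%N.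
Proof. by clear; lia. Qed.

Lemma hom_le i j l e e' a b : (i < j)%N -> (j < l < N)%N ->
  (a <= r.+1)%N -> (b <= r.+1)%N ->
  (triangle X i j l e a <= triangle X i j l e' b) =
  (triangle X 0%N 1%N 2%N e a <= triangle X 0%N 1%N 2%N e' b).
Proof. by move=> *; rewrite !leNgt (hom_cmp hX (i':=0) (j':=1) (l':=2)) //; lia. Qed.

Lemma homS_gt1 i j : (i < j < N)%N -> 1 < X i j r.+1.
Proof. by move=> ij; rewrite (homS hX) ?ltr1n. Qed.

Lemma hom0_lt0 i j : (i < j < N)%N -> X i j 0%N < 0.
Proof. by move=> ij; rewrite (hom0 hX) ?ltrN10. Qed.

(** These parities would order the three paths cyclically at [t]. The hypotheses are single
    inequalities, so that [lra] can discharge them. *)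
Lemma acyclic i j l a b c t : (i < j)%N -> (j < l < N)%N ->
  (a <= r)%N -> (b <= r)%N -> (c <= r)%N -> odd a = odd b -> odd c != odd a ->
  0 < t -> t < 1 -> X i j a < t -> t < X i j a.+1 ->
  X j l b < t -> t < X j l b.+1 -> X i l c < t -> t < X i l c.+1 -> False.
Proof.
move=> ij jl ar br cr oab oca t0 t1 *.
move/eqP: oca; apply; apply: (hom_acyclic hX ij jl ar br cr (t := t)) => //; apply/andP;
  split => //; exact: ltW.
Qed.

(** By the sentinels, gap 0 of every pair contains time 0 and gap [r] contains time 1; so these gaps
    always overlap. *)
Lemma EL0 : EL 0 0.
Proof. by apply/andP; split; apply: (lt_trans (hom0_lt0 _) (homS_gt0 _ _)); lia. Qed.

Lemma ELr : EL r r.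
Proof. by apply/andP; split; apply: (lt_trans (hom_lt1 _ _) (homS_gt1 _)); lia. Qed.

Lemma ERr : ER r r.
Proof. by apply/andP; split; apply: (lt_trans (hom_lt1 _ _) (homS_gt1 _)); lia. Qed.

(* If t were in gap 1 of (i, j), gap 3 of (j, l) and gap 0 of (i, l), then
   p_l < p_j < p_i < p_l at t. Excluding a few such cycles orders enough crossing
   times on four paths to close a strict cycle of inequalities. *)
Lemma no_r3 : r = 3 -> EM 0 1 -> EM 2 3 -> ~~ EM 0 3 -> ~~ EM 2 1 ->
  ~~ EL 2 2 -> ~~ ER 1 1 -> False.
Proof.
have N2 : (1 < 2 < N)%N by rewrite (leq_trans _ N6).
have N3 : (2 < 3 < N)%N by rewrite (leq_trans _ N6).
have N13 : (1 < 3 < N)%N by rewrite (leq_trans _ N6).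
move=> r3 em01 em23 em03 em21 /overlapN el /overlapN er.
(* The [EM] hypotheses as inequalities on any triple; the first one is strict because no three paths
   meet. *)
have T i j l : (i < j)%N -> (j < l < N)%N ->
  [/\ [/\ x i j 1 < x j l 3, x j l 1 < x i j 1, x j l 2 <= x i j 2 & x j l 3 < x i j 3],
      [/\ 0 < x i j 1, x i j 1 < x i j 2, x i j 2 < x i j 3 & x i j 3 < 1],
      [/\ 0 < x j l 1, x j l 1 < x j l 2, x j l 2 < x j l 3 & x j l 3 < 1] &
      [/\ 0 < x i l 1, x i l 1 < x i l 2, x i l 2 < x i l 3 & x i l 3 < 1]].
  move=> ij jl; have [ijN ilN] := lt_pairs ij jl.
  have ne : X i j 1%N != X j l 3 by apply: (hom_neq hX); rewrite ?r3.
  have I h k : (h < k < N)%N ->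
      [/\ 0 < x h k 1, x h k 1 < x h k 2, x h k 2 < x h k 3 & x h k 3 < 1].
    move=> hk; split; first by apply: homS_gt0.
    - by apply: (hom_incr hX); rewrite ?r3.
    - by apply: (hom_incr hX); rewrite ?r3.
    - by apply: hom_lt1; rewrite ?r3.
  move: em01 em23 em03 em21; rewrite -!(EME ij jl) ?r3 //.
  have [? ? ? ?] := I i j ijN; have [? ? ? ?] := I j l jl.
  have [? ? ? ?] := I i l ilN.
  have := hom0_lt0 ijN; have := homS_gt1 jl; rewrite r3 => ? ?.
  move=> /andP[? ?] /andP[? ?] /overlapN m03 /overlapN m21.
  by split; split=> //; try lra; rewrite lt_neqAle ne; lra.
(* A comparison on the paths 0, 1, 2 transfers to all triples. *)
have TL e e' a b : triangle X 0%N 1%N 2%N e a <= triangle X 0%N 1%N 2%N e' b ->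
   (a <= 4)%N -> (b <= 4)%N ->
   forall i j l, (i < j)%N -> (j < l < N)%N -> triangle X i j l e a <= triangle X i j l e' b.
  by move=> h a4 b4 i j l ij jl; rewrite hom_le ?r3.
have caseP : x 0 1 2 <= x 0 2 1 -> False.
  move=> /(TL 0 1 2%N 1%N)/(_ isT isT) p.
  have q i j l : (i < j)%N -> (j < l < N)%N -> x j l 3 <= x i l 2.
    move=> ij jl; have [[? ? ? ?] [? ? ? ?] [? ? ? ?] [? ? ? ?]] := T _ _ _ ij jl.
    have := p _ _ _ ij jl; rewrite /triangle /= => ?.
    move: el; rewrite or_comm => -[/(TL 1 2%:R)|/(TL 2%:R 1)]/(_ isT isT i j l ij jl);
      rewrite /triangle /=; lra.
  have p1 i j l : (i < j)%N -> (j < l < N)%N -> x i j 2 <= x j l 3.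
    move=> ij jl; have := homS_gt1 jl; rewrite r3 => ?.
    have [_ /hom0_lt0 ?] := lt_pairs ij jl.
    have [[? ? ? ?] [? ? ? ?] [? ? ? ?] [? ? ? ?]] := T _ _ _ ij jl.
    have := p _ _ _ ij jl; rewrite /triangle /= => ?; have ? := q _ _ _ ij jl.
    rewrite leNgt; apply/negP => lt; have [t [? ?]] := exists_between lt.
    by apply: (@acyclic i j l 1%N 3%N 0%N t); rewrite ?r3 //; lra.
  have p2 i j l : (i < j)%N -> (j < l < N)%N -> x j l 3 <= x i l 1.
    move=> ij jl; have [[? ? ? ?] [? ? ? ?] [? ? ? ?] [? ? ? ?]] := T _ _ _ ij jl.
    have := p _ _ _ ij jl; rewrite /triangle /= => ?; have ? := q _ _ _ ij jl.
    rewrite leNgt; apply/negP => lt; have [t [? ?]] := exists_between lt.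
    by apply: (@acyclic i j l 2%N 2%N 1%N t); rewrite ?r3 //; lra.
  (* The cycle is [x 2 3 3 < x 1 2 3 <= x 0 2 1 < x 0 2 2 <= x 2 3 3]. *)
  have := p1 0%N 2%N 3%N isT N3; have := p2 0%N 1%N 2%N isT N2.
  have [[? ? ? ?] _ _ _] := T 1%N 2%N 3%N isT N3.
  have [_ _ _ [? ? ? ?]] := T 0%N 1%N 2%N isT N2.
  lra.
have caseS : x 0 2 3 <= x 1 2 2 -> False.
  move=> /(TL 1 2%:R 3%N 2%N)/(_ isT isT) p.
  have q i j l : (i < j)%N -> (j < l < N)%N -> x i l 2 <= x i j 1.
    move=> ij jl; have [[? ? ? ?] [? ? ? ?] [? ? ? ?] [? ? ? ?]] := T _ _ _ ij jl.
    have := p _ _ _ ij jl; rewrite /triangle /= => ?.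
    move: er => -[/(TL 1 0)|/(TL 0 1)]/(_ isT isT i j l ij jl);
      rewrite /triangle /=; lra.
  have p1 i j l : (i < j)%N -> (j < l < N)%N -> x i j 1 <= x j l 2.
    move=> ij jl; have [/hom0_lt0 ? /homS_gt1] := lt_pairs ij jl; rewrite r3 => ?.
    have [[? ? ? ?] [? ? ? ?] [? ? ? ?] [? ? ? ?]] := T _ _ _ ij jl.
    have := p _ _ _ ij jl; rewrite /triangle /= => ?; have ? := q _ _ _ ij jl.
    rewrite leNgt; apply/negP => lt; have [t [? ?]] := exists_between lt.
    by apply: (@acyclic i j l 0%N 2%N 3%N t); rewrite ?r3 //; lra.
  have p2 i j l : (i < j)%N -> (j < l < N)%N -> x i l 3 <= x i j 1.
    move=> ij jl; have [[? ? ? ?] [? ? ? ?] [? ? ? ?] [? ? ? ?]] := T _ _ _ ij jl.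
    have := p _ _ _ ij jl; rewrite /triangle /= => ?; have ? := q _ _ _ ij jl.
    rewrite leNgt; apply/negP => lt; have [t [? ?]] := exists_between lt.
    by apply: (@acyclic i j l 1%N 1%N 2%N t); rewrite ?r3 //; lra.
  (* The cycle is [x 0 1 1 <= x 1 3 2 < x 1 3 3 <= x 1 2 1 < x 0 1 1]. *)
  have := p1 0%N 1%N 3%N isT N13; have := p2 1%N 2%N 3%N isT N3.
  have [[? ? ? ?] _ _ _] := T 0%N 1%N 2%N isT N2.
  have [_ _ _ [? ? ? ?]] := T 1%N 2%N 3%N isT N3.
  lra.
(* What remains is [x 1 2 3 <= x 0 2 2 <= x 0 1 1], against [lt13]. *)
have [[lt13 _ _ _] _ _ _] := T 0%N 1%N 2%N isT N2.
case: el => [el|//]; case: er => [er|//].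
by have := lt_le_trans (le_lt_trans er lt13) el; rewrite ltxx.
Qed.

(** The failures of [EL 2 2] and [ER 3 3] each leave two orders of disjoint gaps. Two of the four
    combinations contradict the order of the crossing times at once; each of the others yields a
    time at which three paths would be cyclically ordered. *)
Lemma no_r4 : r = 4 -> ~~ EM 0 1 -> ~~ EM 4 1 -> EM 2 1 -> EM 0 3 || EM 4 3 ->
  ~~ EM 2 3 -> ~~ EL 2 2 -> ~~ ER 3 3 -> False.
Proof.
have N2 : (1 < 2 < N)%N by rewrite (leq_trans _ N6).
have N3 : (2 < 3 < N)%N by rewrite (leq_trans _ N6).
have N13 : (1 < 3 < N)%N by rewrite (leq_trans _ N6).
move=> r4 em01 em41 em21 em3 em23 /overlapN el /overlapN er.
have T i j l : (i < j)%N -> (j < l < N)%N ->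
  [/\ [/\ x i j 1 <= x j l 1, x j l 2 < x i j 4 & x i j 2 < x j l 2],
      [/\ x j l 1 < x i j 3, x i j 3 <= x j l 3 & x i j 4 < x j l 4],
      [/\ 0 < x i j 1, x i j 1 < x i j 2, x i j 2 < x i j 3, x i j 3 < x i j 4 & x i j 4 < 1],
      [/\ 0 < x j l 1, x j l 1 < x j l 2, x j l 2 < x j l 3, x j l 3 < x j l 4 & x j l 4 < 1] &
      [/\ 0 < x i l 1, x i l 1 < x i l 2, x i l 2 < x i l 3, x i l 3 < x i l 4 & x i l 4 < 1]].
  move=> ij jl; have [ijN ilN] := lt_pairs ij jl.
  have ne : X j l 2 != X i j 4%N by rewrite eq_sym; apply: (hom_neq hX); rewrite ?r4.
  have I h k : (h < k < N)%N ->
      [/\ 0 < x h k 1, x h k 1 < x h k 2, x h k 2 < x h k 3, x h k 3 < x h k 4 & x h k 4 < 1].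
    move=> hk; split; first by apply: homS_gt0.
    - by apply: (hom_incr hX); rewrite ?r4.
    - by apply: (hom_incr hX); rewrite ?r4.
    - by apply: (hom_incr hX); rewrite ?r4.
    - by apply: hom_lt1; rewrite ?r4.
  move: em01 em41 em21 em3 em23; rewrite -!(EME ij jl) ?r4 //.
  have [? ? ? ? ?] := I i j ijN; have [? ? ? ? ?] := I j l jl.
  have [? ? ? ? ?] := I i l ilN.
  have := hom0_lt0 ijN; have := homS_gt1 ijN; rewrite r4 => ? ?.
  move=> /overlapN m01 /overlapN m41 /andP[? ?] m3 /overlapN m23.
  have {}m01 : x i j 1 <= x j l 1 by lra.
  have {}m41 : x j l 2 < x i j 4 by rewrite lt_neqAle ne; lra.
  have {}m23 : x i j 3 <= x j l 3 by lra.
  have {}m3 : x i j 4 < x j l 4 by move/orP: m3 => -[/andP[? ?]|/andP[? ?]]; lra.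
  by [].
have TL e e' a b : triangle X 0%N 1%N 2%N e a <= triangle X 0%N 1%N 2%N e' b ->
   (a <= 5)%N -> (b <= 5)%N ->
   forall i j l, (i < j)%N -> (j < l < N)%N -> triangle X i j l e a <= triangle X i j l e' b.
  by move=> h a5 b5 i j l ij jl; rewrite hom_le ?r4.
have p1 : x 1 2 3 <= x 0 2 2 -> x 0 1 4 <= x 0 2 3 -> x 1 2 4 <= x 1 3 2.
  move=> el13 er13.
  have [[? ? ?] [? ? ?] [? ? ? ? ?] [? ? ? ? ?] [? ? ? ? ?]] := T 1%N 2%N 3%N isT N3.
  have := TL 2%:R 1 _ _ el13 isT isT 1%N 2%N 3%N isT N3; rewrite /triangle /= => ?.
  have := TL 0 1 _ _ er13 isT isT 1%N 2%N 3%N isT N3; rewrite /triangle /= => ?.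
  rewrite leNgt; apply/negP => lt; have [t [? ?]] := exists_between lt.
  by apply: (@acyclic 1%N 2%N 3%N 3%N 3%N 2%N t); rewrite ?r4 //; lra.
have T012 := T 0%N 1%N 2%N isT N2.
move: T012 => [[? ? ?] [? ? ?] [? ? ? ? ?] [? ? ? ? ?] [? ? ? ? ?]].
case: el => el; case: er => er; [by move: el er; lra| |idtac|by move: el er; lra].
- have [[_ p2 _] _ _ _ _] := T 0%N 1%N 3%N isT N13.
  by move: (p1 el er) p2; lra.
- have [[_ _ p2] _ _ _ _] := T 1%N 2%N 3%N isT N3.
  (* By homogeneity this may be tested on the paths 0, 2, 3, where
     [x 0 2 3 <= x 1 2 2 < x 2 3 2]. *)
  have lt : x 0 1 3 < x 1 2 2.
    have := @hom_cmp _ _ _ _ hX 0%N 1%N 2%N 0%N 2%N 3%N 0 2%:R 3%N 2%N isT N2 isT N3.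
    by rewrite r4 /triangle /= => -> //; apply: le_lt_trans el p2.
  have [t [? ?]] := exists_between lt.
  have := homS_gt1 (i := 0%N) (j := 2%N) (lt_pairs (i := 0%N) (j := 1%N) isT N2).2; rewrite r4 => ?.
  by apply: (@acyclic 0%N 1%N 2%N 3%N 1%N 4%N t); rewrite ?r4 //; lra.
Qed.

End Homogeneous.

(** * Time reversal *)

(* The pattern of the time-reversed paths. For even r the order of the right
   endpoints is that of the left ones, so the pattern stays homogeneous. *)
Definition reversed (R : realFieldType) r (X : nat -> nat -> nat -> R) i j a :=
  1 - X i j (r.+1 - a)%N.

Lemma ltr1B (R : realFieldType) (u v : R) : (1 - u < 1 - v) = (v < u).
Proof. by rewrite ltrD2l ltrN2. Qed.

Lemma homogeneous_reversed (R : realFieldType) N r (X : nat -> nat -> nat -> R) :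
  ~~ odd r -> homogeneous N r X -> homogeneous N r (reversed r X).
Proof.
move=> er hX; split; rewrite /reversed.
- by move=> i j ij; rewrite subn0 (homS hX) //; lra.
- by move=> i j ij; rewrite subnn (hom0 hX) //; lra.
- move=> i j a ij ar; rewrite ltr1B subSS subSn //; apply: (hom_incr hX) => //.
  exact: leq_subr.
- move=> i j a ij ar; have /andP[] : 0 < X i j (r.+1 - a)%N < 1.
    by apply: (hom_itv hX) => //; lia.
  by move=> ? ?; apply/andP; split; lra.
- move=> i j l a b ij jl ar br; have : X i j (r.+1 - a)%N != X j l (r.+1 - b)%N.
    by apply: (hom_neq hX) => //; lia.
  by apply: contraNneq => /addrI/oppr_inj ->.
- move=> i j l a b c t ij jl ar br cr /andP[t0 t1] ta tb tc oab.
  (* Gap [d] of the reversed pattern is the mirror image of gap [r - d], which has the same parity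
     as [r] is even. *)
  have flip h k d : (d <= r)%N ->
      1 - X h k (r.+1 - d)%N < t < 1 - X h k (r.+1 - d.+1)%N ->
      X h k (r - d)%N < 1 - t < X h k (r - d).+1.
    by move=> dr; rewrite subSS subSn // => /andP[? ?]; apply/andP; split; lra.
  have oflip d : (d <= r)%N -> odd (r - d) = odd d.
    by move=> dr; rewrite oddB // (negPf er).
  rewrite -(oflip a) // -(oflip c) //.
  apply: (hom_acyclic hX ij jl (leq_subr a r) (leq_subr b r) (leq_subr c r)
    _ (flip _ _ _ ar ta) (flip _ _ _ br tb) (flip _ _ _ cr tc)).
    by apply/andP; split; lra.
  by rewrite !oflip.
- move=> i j l i' j' l' e e' a b ij jl ij' jl' ar br.
  have flip h k m f d : triangle (fun i0 j0 a0 => 1 - X i0 j0 (r.+1 - a0)%N) h k m f d =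
      1 - triangle X h k m f (r.+1 - d)%N.
    by case: f => [[|[|f]] hf].
  by rewrite !flip !ltr1B; apply: (hom_cmp hX) => //; apply: leq_subr.
Qed.

Lemma overlap_reversed (R : realFieldType) r (X : nat -> nat -> nat -> R) i j h l a b :
  (a <= r)%N -> (b <= r)%N ->
  overlap (reversed r X i j) a (reversed r X h l) b =
  overlap (X i j) (r - a) (X h l) (r - b).
Proof.
by move=> ar br; rewrite /overlap /reversed !ltr1B andbC !subSS !subSn.
Qed.

(** * Finding gaps common to all paths *)

Section Homogeneous.
Variables (R : realFieldType) (N r : nat).
Hypothesis (N6 : (6 <= N)%N).
Implicit Types X : nat -> nat -> nat -> R.

(* Gap [a] below and gap [b] above each path: by Helly's theorem on the line a
   single time witnesses that the path is on the upper envelope. *)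
Definition common_gaps X := exists a b,
  [/\ (a <= r)%N && ~~ odd a, (b <= r)%N && odd b, EL X a a, ER X b b & EM X a b].

(** The trace of a time at which a path is above two paths that start lower (gaps [a], [a']) and one
    that starts higher (gap [b]). In [above_pair] one starts lower and two start higher. *)
Definition below_pair X := exists a a' b,
  [/\ [&& a <= r, a' <= r & b <= r]%N, [&& ~~ odd a, ~~ odd a' & odd b],
      EL X a a', EM X a b & EM X a' b].

Definition above_pair X := exists a b b',
  [/\ [&& a <= r, b <= r & b' <= r]%N, [&& ~~ odd a, odd b & odd b'],
      ER X b b', EM X a b & EM X a b'].

(** For [r <= 2] an even gap is the first or the last one, so it overlaps its likes for free, and
    the only odd index is 1. *)
Lemma common_gaps2 X a b c c' : homogeneous N r X -> (r <= 2)%N ->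
  (a <= r)%N && ~~ odd a -> (b <= r)%N && odd b ->
  (c <= r)%N && odd c -> (c' <= r)%N && odd c' -> EM X a b -> ER X c c' -> common_gaps X.
Proof.
move=> hX r2 ar br cr c'r ab cc; exists a, b; split => //.
- have [->|a0] := eqVneq a 0%N; first exact: (EL0 N6 hX).
  by have -> : a = r by [lia]; exact: (ELr N6 hX).
- by move: cc; have -> : c = b by [lia]; have -> : c' = b by [lia].
Qed.

(** [EL 0 0] and [ER 3 3] always hold, so [EM 0 3] would suffice. If [EL 2 2] holds, the gaps of
    [above_pair] serve; if [ER 1 1] holds, those of [below_pair] do. Otherwise the pattern is the
    one excluded by [no_r3]. *)
Lemma common_gaps3 X : homogeneous N r X -> r = 3 -> below_pair X -> above_pair X -> common_gaps X.
Proof.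
move=> hX r3 [a [a' [b [/and3P[ar a'r br] /and3P[ea ea' ob] aa ab a'b]]]].
move=> [c [d [d' [/and3P[cr dr d'r] /and3P[ec od od'] dd cd cd']]]].
have E x : (x <= r)%N -> ~~ odd x -> x = 0%N \/ x = 2%N by clear -r3; lia.
have O x : (x <= r)%N -> odd x -> x = 1%N \/ x = 3%N by clear -r3; lia.
have el0 := EL0 N6 hX; have er3 : ER X 3 3 by have := ERr N6 hX; rewrite r3.
have [em03|em03] := boolP (EM X 0 3); first by exists 0%N, 3%N; rewrite r3.
have [el2|el2] := boolP (EL X 2 2).
  have el x : (x <= r)%N -> ~~ odd x -> EL X x x by move=> xr ex; case: (E x xr ex) => ->.
  case: (O d dr od) (O d' d'r od') => d1; last first.
    by move=> _; subst d; exists c, 3%N; split; rewrite ?cr ?ec ?el ?dr ?d'r.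
  case=> d1'; subst d d'.
    by exists c, 1%N; split; rewrite ?cr ?ec ?el ?dr ?d'r.
  by exists c, 3%N; split; rewrite ?cr ?ec ?el ?dr ?d'r.
have a02 : a = 0%N \/ a' = 0%N.
  case: (E a ar ea) (E a' a'r ea') => [|a2]; first by left.
  by case=> [|a2']; [right|rewrite a2 a2' (negPf el2) in aa].
have em0b : EM X 0 b by case: a02 => <-.
have [er1|er1] := boolP (ER X 1 1).
  by exists 0%N, b; split; rewrite // ?br ?ob //; case: (O b br ob) => ->.
have em01 : EM X 0 1 by case: (O b br ob) em0b => -> //; rewrite (negPf em03).
have d3 : d = 3%N \/ d' = 3%N.
  case: (O d dr od) (O d' d'r od') => [d1|]; last by left.
  by case=> [d1'|]; [rewrite d1 d1' (negPf er1) in dd|right].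
have emc3 : EM X c 3 by case: d3 => <-.
have em23 : EM X 2 3 by case: (E c cr ec) emc3 => -> //; rewrite (negPf em03).
have em21 : ~~ EM X 2 1.
  apply/negP => /(fun em ar br => EM_refl N6 hX ar br em).
  by rewrite r3 (negPf el2) (negPf er1) => /(_ isT isT).
by case: (no_r3 N6 hX r3 em01 em23 em03 em21 el2 er1).
Qed.

(** Reversal exchanges the odd gaps 1 and 3, so this covers both cases in which exactly one of
    [ER 1 1], [ER 3 3] holds. [EL 0 0] and [EL 4 4] are automatic; if no choice of gaps works, the
    pattern is that of [no_r4]. *)
Lemma common_gaps4_half X : homogeneous N r X -> r = 4 -> below_pair X -> above_pair X ->
  ER X 1 1 -> ~~ ER X 3 3 -> common_gaps X.
Proof.
move=> hX r4 [a [a' [b [/and3P[ar a'r br] /and3P[ea ea' ob] aa ab a'b]]]].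
move=> [c [d [d' [/and3P[cr dr d'r] /and3P[ec od od'] dd cd cd']]]] er1 er3.
have E x : (x <= r)%N -> ~~ odd x -> [\/ x = 0, x = 2 | x = 4]%N.
  clear -r4 => xr ex; have [|[|]] : x = 0%N \/ x = 2%N \/ x = 4%N by lia.
  - by constructor 1.
  - by constructor 2.
  - by constructor 3.
have O x : (x <= r)%N -> odd x -> x = 1%N \/ x = 3%N by clear -r4; lia.
have el0 := EL0 N6 hX; have el4 : EL X 4 4 by have := ELr N6 hX; rewrite r4.
have [em01|em01] := boolP (EM X 0 1); first by exists 0%N, 1%N; rewrite r4.
have [em41|em41] := boolP (EM X 4 1); first by exists 4%N, 1%N; rewrite r4.
have d1 : d = 1%N \/ d' = 1%N.
  case: (O d dr od) (O d' d'r od') => [|d3]; first by left.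
  by case=> [|d3']; [right|rewrite d3 d3' (negPf er3) in dd].
have emc1 : EM X c 1 by case: d1 => <-.
have em21 : EM X 2 1.
  by case: (E c cr ec) emc1 => -> //; rewrite ?(negPf em01) ?(negPf em41).
have [el2|el2] := boolP (EL X 2 2); first by exists 2%N, 1%N; rewrite r4.
have em23 : ~~ EM X 2 3.
  apply/negP => /(fun em ar br => EM_refl N6 hX ar br em).
  by rewrite r4 (negPf el2) (negPf er3) => /(_ isT isT).
have em3 : EM X 0 3 || EM X 4 3.
  have [a0 [ar0 ea0 a02 a0b]] : exists a0, [/\ (a0 <= r)%N, ~~ odd a0, a0 <> 2%N & EM X a0 b].
    have [a2|/eqP a2] := eqVneq a 2%N; last by exists a.
    by exists a'; split => // a2'; rewrite a2 a2' (negPf el2) in aa.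
  case: (E a0 ar0 ea0) (O b br ob) a0b => [->|//|->] [->|->] em;
    by rewrite ?em ?orbT //; move: em; rewrite ?(negPf em01) ?(negPf em41).
by case: (no_r4 N6 hX r4 em01 em41 em21 em3 em23 el2 er3).
Qed.

Lemma below_pair_reversed X : ~~ odd r -> below_pair X -> below_pair (reversed r X).
Proof.
move=> er [a [a' [b [/and3P[ar a'r br] /and3P[ea ea' ob] aa ab a'b]]]].
exists (r - a)%N, (r - a')%N, (r - b)%N.
by rewrite /EL /EM !overlap_reversed ?leq_subr // !subKn // !oddB // (negPf er) ea ea' ob.
Qed.

Lemma above_pair_reversed X : ~~ odd r -> above_pair X -> above_pair (reversed r X).
Proof.
move=> er [a [b [b' [/and3P[ar br b'r] /and3P[ea ob ob'] bb ab ab']]]].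
exists (r - a)%N, (r - b)%N, (r - b')%N.
by rewrite /ER /EM !overlap_reversed ?leq_subr // !subKn // !oddB // (negPf er) ea ob ob'.
Qed.

Lemma common_gaps_reversed X : ~~ odd r -> common_gaps (reversed r X) -> common_gaps X.
Proof.
move=> er [a [b [/andP[ar ea] /andP[br ob]]]].
rewrite /ER /EL /EM !overlap_reversed // => aa bb ab.
exists (r - a)%N, (r - b)%N.
by rewrite !leq_subr !oddB // (negPf er) ea ob.
Qed.

Lemma common_gaps4 X : homogeneous N r X -> r = 4 -> below_pair X -> above_pair X -> common_gaps X.
Proof.
move=> hX r4 bp ap; have er : ~~ odd r by rewrite r4.
have O x : (x <= r)%N -> odd x -> x = 1%N \/ x = 3%N by clear -r4; lia.
have er13 : ER X 1 1 || ER X 3 3.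
  have [a [b [b' [/and3P[ar br b'r] /and3P[ea ob ob'] bb _ _]]]] := ap.
  have := ER_refl N6 hX br b'r bb.
  by case: (O b br ob) (O b' b'r ob') => -> [] ->; rewrite ?orbb // 1?orbC => ->; rewrite ?orbT.
have [er1|er1] := boolP (ER X 1 1); have [er3|er3] := boolP (ER X 3 3).
- have [a [a' [b [/and3P[ar a'r br] /and3P[ea ea' ob] aa ab a'b]]]] := bp.
  have bb : ER X b b by case: (O b br ob) => ->.
  have [el|el] := orP (EL_refl N6 hX ar a'r aa).
    by exists a, b; rewrite ar br ea ob.
  by exists a', b; rewrite a'r br ea' ob.
- exact: common_gaps4_half.
- apply: common_gaps_reversed => //; apply: common_gaps4_half => //.
  + exact: homogeneous_reversed.
  + exact: below_pair_reversed.
  + exact: above_pair_reversed.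
  + by rewrite /ER overlap_reversed r4.
  + by rewrite /ER overlap_reversed r4.
- by rewrite (negPf er1) (negPf er3) in er13.
Qed.

(** Upper convexity of all subsystems of size [q + 1], expressed in the pattern alone. *)
Definition dominates q X := forall i (J : seq nat), (i < N)%N -> uniq (i :: J) ->
  all (gtn N) J -> size J = q ->
  exists2 t, 0 <= t <= 1 & forall j, j \in J -> exists a, component r X i j a t.

Lemma component_below X i j a t : (j < i)%N -> component r X i j a t ->
  [/\ (a <= r)%N, ~~ odd a & X j i a < t < X j i a.+1].
Proof.
move=> ji; rewrite /component /points ltnNge (ltnW ji) /=.
by move=> /and3P[-> /eqP/negbT -> ->].
Qed.

Lemma component_above X i j a t : (i < j)%N -> component r X i j a t ->
  [/\ (a <= r)%N, odd a & X i j a < t < X i j a.+1].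
Proof. by rewrite /component /points => -> /and3P[-> /eqP -> ->]. Qed.

Lemma overlapI (u v : nat -> R) a b t : u a < t < u a.+1 -> v b < t < v b.+1 -> overlap u a v b.
Proof.
move=> /andP[ua au] /andP[vb bv].
by rewrite /overlap (lt_trans ua bv) (lt_trans vb au).
Qed.

Lemma below_pairI X : homogeneous N r X -> dominates 3 X -> below_pair X.
Proof.
move=> hX dX; have [||t _ tP] := dX 2%N [:: 0; 1; 3]%N _ isT _ erefl.
- by rewrite (leq_trans _ N6).
- by rewrite /= !(leq_trans _ N6).
have [a /component_below[//|ar ea ta]] := tP 0%N isT.
have [a' /component_below[//|a'r ea' ta']] := tP 1%N isT.
have [b /component_above[//|br ob tb]] := tP 3%N isT.
exists a, a', b; rewrite ar a'r br ea ea' ob.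
split=> //; first exact: overlapI ta ta'.
  rewrite -(@EME _ _ _ _ N6 hX 0 2 3) ?(leq_trans _ N6) //; exact: overlapI ta tb.
rewrite -(@EME _ _ _ _ N6 hX 1 2 3) ?(leq_trans _ N6) //; exact: overlapI ta' tb.
Qed.

Lemma above_pairI X : homogeneous N r X -> dominates 3 X -> above_pair X.
Proof.
move=> hX dX; have [||t _ tP] := dX 1%N [:: 0; 2; 3]%N _ isT _ erefl.
- by rewrite (leq_trans _ N6).
- by rewrite /= !(leq_trans _ N6).
have [a /component_below[//|ar ea ta]] := tP 0%N isT.
have [b /component_above[//|br ob tb]] := tP 2%N isT.
have [b' /component_above[//|b'r ob' tb']] := tP 3%N isT.
exists a, b, b'; rewrite ar br b'r ea ob ob'.
split=> //; last 2 first.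
- exact: overlapI ta tb.
- by rewrite -(@EME _ _ _ _ N6 hX 0 1 3) ?(leq_trans _ N6) //; exact: overlapI ta tb'.
by rewrite -(@ERE _ _ _ _ N6 hX 1 2 3) ?(leq_trans _ N6) //; exact: overlapI tb tb'.
Qed.

Lemma common_gapsI X : homogeneous N r X ->
  [\/ (r <= 2)%N /\ dominates 2 X, (r <= 4)%N /\ dominates 3 X | dominates 4 X] -> common_gaps X.
Proof.
move=> hX [[r2 dX]|[r4 dX]|dX].
(* Path 1 above 0 and 2 gives the even and the odd gap; path 0 above 1 and 2 then gives the overlap
   of odd gaps. *)
- have [||t _ tP] := dX 1%N [:: 0; 2]%N _ isT _ erefl.
  + by rewrite (leq_trans _ N6).
  + by rewrite /= !(leq_trans _ N6).
  have [a /component_below[//|ar ea ta]] := tP 0%N isT.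
  have [b /component_above[//|br ob tb]] := tP 2%N isT.
  have [||s _ sP] := dX 0%N [:: 1; 2]%N _ isT _ erefl.
  + by rewrite (leq_trans _ N6).
  + by rewrite /= !(leq_trans _ N6).
  have [c /component_above[//|cr oc tc]] := sP 1%N isT.
  have [c' /component_above[//|c'r oc' tc']] := sP 2%N isT.
  by apply: (common_gaps2 hX r2 (a := a) (b := b) (c := c) (c' := c')); rewrite ?ar ?br ?cr ?c'r //;
    [exact: overlapI ta tb|exact: overlapI tc tc'].
- have bp := below_pairI hX dX; have ap := above_pairI hX dX.
  have [r2|r2] := leqP r 2.
    have [c [d [d' [/and3P[cr dr d'r] /and3P[ec od od'] dd cd cd']]]] := ap.
    by apply: (common_gaps2 hX r2 (a := c) (b := d) (c := d) (c' := d')); rewrite ?cr ?dr ?d'r.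
  have [r3|r3] := eqVneq r 3; first exact: common_gaps3.
  by apply: common_gaps4 => //; lia.
(* Path 2 has two paths on either side. All four combinations of a lower and a higher gap overlap,
   so the gaps selected by [EL_refl] and [ER_refl] are compatible. *)
have [||t _ tP] := dX 2%N [:: 0; 1; 3; 4]%N _ isT _ erefl.
- by rewrite (leq_trans _ N6).
- by rewrite /= !(leq_trans _ N6).
have [a /component_below[//|ar ea ta]] := tP 0%N isT.
have [a' /component_below[//|a'r ea' ta']] := tP 1%N isT.
have [b /component_above[//|br ob tb]] := tP 3%N isT.
have [b' /component_above[//|b'r ob' tb']] := tP 4%N isT.
have aa : EL X a a' by exact: overlapI ta ta'.
have bb : ER X b b'.
  by rewrite -(@ERE _ _ _ _ N6 hX 2 3 4) ?(leq_trans _ N6) //; exact: overlapI tb tb'.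
have EMI h k c d : (h < 2)%N -> (2 < k < N)%N -> (c <= r)%N -> (d <= r)%N ->
    X h 2%N c < t < X h 2%N c.+1 -> X 2%N k d < t < X 2%N k d.+1 -> EM X c d.
  move=> h2 k2 cr dr tc td; rewrite -(@EME _ _ _ _ N6 hX h 2 k) //; exact: overlapI tc td.
have N3 : (2 < 3 < N)%N by rewrite (leq_trans _ N6).
have N4 : (2 < 4 < N)%N by rewrite (leq_trans _ N6).
have [el|el] := orP (EL_refl N6 hX ar a'r aa); have [er|er] := orP (ER_refl N6 hX br b'r bb).
- exists a, b; rewrite ar ea br ob; split=> //; exact: (EMI 0%N 3%N).
- exists a, b'; rewrite ar ea b'r ob'; split=> //; exact: (EMI 0%N 4%N).
- exists a', b; rewrite a'r ea' br ob; split=> //; exact: (EMI 1%N 3%N).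
- exists a', b'; rewrite a'r ea' b'r ob'; split=> //; exact: (EMI 1%N 4%N).
Qed.

Lemma homogeneous_envelope X i : homogeneous N r X -> common_gaps X -> (i < N)%N ->
  exists2 t, 0 <= t <= 1 & forall j, (j < N)%N -> j != i -> exists a, component r X i j a t.
Proof.
move=> hX [a [b [/andP[ar ea] /andP[br ob] el er em]]] iN.
have [t t01 tP] := common_component N6 hX ar br ea ob el er em iN.
by exists t => // j jN ji; eexists; apply: tP.
Qed.

End Homogeneous.

(** * Crossings of two paths *)

Section PathPair.
Variables (R : realType) (f g : R -> R).
Hypotheses (cf : is_path f) (cg : is_path g).

Lemma same_side (a b : R) : 0 <= a -> a <= b -> b <= 1 ->
  (forall s, a <= s <= b -> f s != g s) -> (g a < f a) = (g b < f b).
Proof.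
move=> a0 ab b1 fg.
have sub : `[a, b]%classic `<=` `[0 : R, 1]%classic.
  move=> x /=; rewrite !in_itv /= => /andP[ax xb].
  by rewrite (le_trans a0 ax) (le_trans xb b1).
have ch := within_continuousB (continuous_subspaceW sub cf) (continuous_subspaceW sub cg).
have [|nIVT] := pselect (exists2 c, c \in `[a, b] & (f - g) c = 0).
  move=> [c]; rewrite in_itv /= => cab /eqP; rewrite subr_eq0 => fgc.
  by rewrite (negPf (fg c cab)) in fgc.
have fga := fg a; rewrite lexx ab in fga; have {}fga := fga isT.
have fgb := fg b; rewrite lexx ab in fgb; have {}fgb := fgb isT.
apply/idP/idP => [ga|gb]; rewrite ltNge; apply/negP => h; apply: nIVT;
  apply: (IVT ab ch); rewrite ge_min le_max !fctE !subr_le0 !subr_ge0.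
  by rewrite h orbT (ltW ga).
by rewrite h (ltW gb) orbT.
Qed.

Lemma crosses_near lo x hi : crosses_at f g x -> lo < x -> x < hi ->
  exists s s', [/\ lo < s < x, x < s' < hi &
    (f s < g s) && (g s' < f s') || (g s < f s) && (f s' < g s')].
Proof.
move=> [_ _ C] lox xhi.
have L (P : R -> Prop) : (\forall s \near x^'-, P s) -> exists2 s, lo < s < x & P s.
  move=> H; have [s [Ps [/= ls sx]]] := @filter_ex _ _ (at_left_proper_filter x) _ (filterI H
    (filterI (nbhs_left_gt lox) (nbhs_left_lt x))).
  by exists s => //; apply/andP.
have U (P : R -> Prop) : (\forall s \near x^'+, P s) -> exists2 s, x < s < hi & P s.
  move=> H; have [s [Ps [/= xs sh]]] := @filter_ex _ _ (at_right_proper_filter x) _ (filterI H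
    (filterI (nbhs_right_gt x) (nbhs_right_lt xhi))).
  by exists s => //; apply/andP.
case: C => -[/L[s ls Ps] /U[s' us Ps']]; exists s, s'; split=> //.
  by rewrite Ps Ps'.
by rewrite Ps Ps' orbT.
Qed.

Variable xs : seq R.
Hypotheses (xs_uniq : uniq xs) (fg0 : f 0 < g 0).
Hypothesis xsP : forall x, (x \in xs) = (0 <= x <= 1) && (f x == g x).
Hypothesis xs_cross : forall x, x \in xs -> crosses_at f g x.

Lemma same_side_between a b : 0 <= a -> a <= b -> b <= 1 ->
  (forall x, x \in xs -> ~~ (a <= x <= b)) -> (g a < f a) = (g b < f b).
Proof.
move=> a0 ab b1 h; apply: same_side => // s sab; apply/negP => fgs.
have /h : s \in xs; last by rewrite sab.
by case/andP: sab => as_ sb; rewrite xsP fgs (le_trans a0 as_) (le_trans sb b1).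
Qed.

Lemma odd_crossings0 t : 0 <= t <= 1 -> f t != g t -> ~~ has (< t) xs ->
  (g t < f t) = odd (count (< t) xs).
Proof.
move=> /andP[t0 t1] fgt none; rewrite (_ : count _ _ = 0%N); last first.
  by apply/eqP; rewrite -leqn0 leqNgt -has_count.
rewrite -(@same_side_between 0 t) ?lexx //.
  by apply/negbTE; rewrite -leNgt ltW.
move=> x xxs; apply/negP => /andP[_]; rewrite le_eqVlt => /predU1P[xt|xt].
  by move: xxs; rewrite xt xsP (negPf fgt) andbF.
by case/negP: none; apply/hasP; exists x.
Qed.

(** Induction on the number of crossings before [t]. Around the last one, [x], choose [s < x < s']:
    the order of the paths flips from [s] to [s'] and stays the same from [s'] to [t]. *)
Lemma odd_crossings t : 0 <= t <= 1 -> f t != g t ->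
  (g t < f t) = odd (count (< t) xs).
Proof.
move: {2}(count (< t) xs) (leqnn (count (< t) xs)) => n.
elim: n t => [|n IHn] t nt t01 fgt; have [t0 t1] := andP t01;
  have [/hasP[x0 x0s x0t]|none] := boolP (has (< t) xs).
- by move: nt; rewrite leqn0 => /eqP/eqP; rewrite -leqn0 leqNgt -has_count => /hasPn/(_ _ x0s)/negP.
- exact: odd_crossings0.
- have [x] : exists2 x, x \in [seq y <- xs | y < t] &
      forall y, y \in [seq y <- xs | y < t] -> y <= x.
    by apply: (@seq_max _ _ x0); rewrite mem_filter x0s andbT.
  rewrite mem_filter => /andP[xt xxs] xmax.
  have C := xs_cross xxs; have [] := C; rewrite in_itv /= => /andP[lt0x ltx1] _ _.
  (* [lo] is the crossing before [x], or 0; between [lo] and [x] the count is constant. *)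
  have [lo] : exists2 lo, lo \in 0 :: [seq y <- xs | y < x] &
      forall y, y \in 0 :: [seq y <- xs | y < x] -> y <= lo.
    exact: (seq_max (mem_head _ _)).
  move=> lo_in lomax; have lox : lo < x.
    by move: lo_in; rewrite inE mem_filter => /predU1P[->|/andP[]].
  have lo0 : 0 <= lo by rewrite lomax ?mem_head.
  have cs s : lo < s < x -> count (< s) xs = count (< x) xs.
    move=> /andP[los sx]; apply: eq_in_count => y yxs /=.
    apply/idP/idP => [/lt_trans->//|yx]; apply: le_lt_trans los.
    by apply: lomax; rewrite inE mem_filter yx yxs orbT.
  have ct : count (< t) xs = (count (< x) xs).+1.
    rewrite -addn1 -[1%N]/(nat_of_bool true) -xxs -(count_uniq_mem x xs_uniq).
    rewrite -count_predUI [X in (_ + X)%N](eq_count (a2 := pred0)) ?count_pred0 ?addn0.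
      apply: eq_in_count => y yxs /=; apply/idP/orP => [yt|[yx|/eqP->//]].
        by apply/orP; rewrite orbC -le_eqVlt xmax // mem_filter yt.
      exact: lt_trans yx xt.
    by move=> y /=; apply/negbTE/negP => /andP[yx /eqP yE]; rewrite yE ltxx in yx.
  have [s [s' [ls sx' S]]] := crosses_near C lox xt.
  have [/andP[los sx] /andP[xs' s't]] := (ls, sx').
  have <- : (g s' < f s') = (g t < f t).
    apply: same_side_between; rewrite ?(ltW s't) ?(ltW (lt_trans lt0x xs')) //.
    move=> y yxs; apply/negP => /andP[s'y]; rewrite le_eqVlt => /predU1P[yt|yt].
      by move: yxs; rewrite yt xsP (negPf fgt) andbF.
    have := xmax y; rewrite mem_filter yt yxs => /(_ isT) /(le_trans s'y).
    by rewrite leNgt xs'.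
  have s01 : 0 <= s <= 1 by rewrite (le_trans lo0 (ltW los)) (ltW (lt_trans sx ltx1)).
  have fgs : f s != g s.
    by case/orP: S => /andP[fs _]; rewrite ?(lt_eqF fs) ?(gt_eqF fs).
  rewrite ct /= -(cs s) // -IHn //; last by rewrite cs // -ltnS -ct.
  by case/orP: S => /andP[S1 S2]; rewrite ?S1 ?S2 ?[_ < _]ltNge ?(ltW S1) ?(ltW S2).
- exact: odd_crossings0.
Qed.

End PathPair.

(** The entries before [t] number its gap; the head [x0] and the default [d] of [nth] act as
    sentinels. [gap_count_lt] is the converse. *)
Lemma count_lt_gap (R : realDomainType) (d x0 t : R) (xs : seq R) :
  path <%R x0 xs -> x0 < t -> t < d -> t \notin xs ->
  nth d (x0 :: xs) (count (< t) xs) < t < nth d (x0 :: xs) (count (< t) xs).+1.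
Proof.
elim: xs x0 => [|x xs IH] x0 /=; first by move=> _ -> ->.
move=> /andP[x0x xxs] x0t td; rewrite inE negb_or => /andP[tx txs].
have [xt|tx'] := ltP x t; first exact: IH.
rewrite (eq_in_count (a2 := pred0)) ?count_pred0 /=.
  by rewrite x0t lt_neqAle tx.
move=> y yxs /=; apply/negbTE; rewrite -leNgt (le_trans tx') //.
by apply: ltW; have /allP := order_path_min lt_trans xxs; apply.
Qed.

Lemma gap_count_lt (R : realDomainType) (d x0 t : R) (xs : seq R) a :
  path <%R x0 xs -> (a <= size xs)%N -> nth d (x0 :: xs) a < t < nth d (x0 :: xs) a.+1 ->
  t \notin xs /\ count (< t) xs = a.
Proof.
elim: xs x0 a => [|x xs IH] x0 [|a] //= /andP[x0x xxs].
  move=> _ /andP[x0t tx]; have lt_xs y : y \in xs -> t < y.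
    by have /allP h := order_path_min lt_trans xxs; move=> /h; apply: lt_trans.
  rewrite inE negb_or (lt_eqF tx) ltNge (ltW tx) /=; split.
    by apply/negP => /lt_xs; rewrite ltxx.
  rewrite (eq_in_count (a2 := pred0)) ?count_pred0 // => y /lt_xs /ltW.
  by rewrite leNgt => /negbTE.
rewrite ltnS => asz ht; have [txs ca] := IH x a xxs asz ht.
have xt : x < t.
  case/andP: ht => + _; apply: le_lt_trans; case: a {IH ca} asz => [//|a] asz.
  by apply: ltW; have /allP := order_path_min lt_trans xxs; apply; rewrite /= mem_nth.
by rewrite inE negb_or (gt_eqF xt) xt ca.
Qed.

(** * Crossing times in a system of paths *)

Section System.
Variables (R : realType) (m : nat) (p : 'I_m -> R -> R).
Hypothesis pS : path_system p.

Definition crossing_seq (i j : 'I_m) : seq R :=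
  sort <=%R (enum_fset (fset_set (intersections (p i) (p j)))).

(** The head -1 and the default 2 are the sentinels of [homogeneous]; the head also makes the
    numbering of crossings start at 1. *)
Definition crossing_point (i j : 'I_m) (a : nat) : R := nth 2 (-1 :: crossing_seq i j) a.

Lemma mem_crossing_seq i j x : i != j ->
  (x \in crossing_seq i j) = (0 <= x <= 1) && (p i x == p j x).
Proof.
move=> ij; rewrite mem_sort in_fset_set; last exact: (system_finite pS ij).
apply/idP/idP => [/set_mem[]|/andP[x01 /eqP pij]].
  by rewrite in_itv /= => -> ->; rewrite eqxx.
by apply/mem_set; split=> //; rewrite in_itv.
Qed.

Lemma crossing_seq_path i j : i != j -> path <%R (-1) (crossing_seq i j).
Proof.
move=> ij; rewrite path_sortedE; last exact: lt_trans.
apply/andP; split.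
  apply/allP => x; rewrite mem_crossing_seq // => /andP[/andP[x0 _] _].
  by apply: lt_le_trans x0; rewrite ltrN10.
by rewrite sort_lt_sorted fset_uniq.
Qed.

Lemma crossing_seq_itv i j x : i != j -> x \in crossing_seq i j ->
  crosses_at (p i) (p j) x /\ 0 < x < 1.
Proof.
move=> ij; rewrite mem_crossing_seq // => /andP[x01 /eqP pij].
have C : crosses_at (p i) (p j) x by apply: (system_cross pS).
by split=> //; case: C; rewrite in_itv.
Qed.

Lemma size_crossing_seq k i j : k_crossing k p -> i != j ->
  (size (crossing_seq i j) <= k)%N.
Proof.
move=> pk ij; have [_] := pk i j ij.
have -> : crossings (p i) (p j) = intersections (p i) (p j).
  apply/seteqP; split=> x; last exact: (system_cross pS).
  by case=> x01 pij _; split=> //; apply: subset_itv_oo_cc.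
by move=> /geq_card_fset_set; rewrite size_sort.
Qed.

Lemma crossing_point_lt i j a t : p i 0 < p j 0 -> (a <= size (crossing_seq i j))%N ->
  0 <= t <= 1 -> crossing_point i j a < t < crossing_point i j a.+1 ->
  p i t != p j t /\ (p j t < p i t) = odd a.
Proof.
move=> lt0 asz t01 ta; have ij : i != j.
  by apply: contraTneq lt0 => ->; rewrite ltxx.
have [nt ct] := @gap_count_lt _ 2 _ _ _ _ (crossing_seq_path ij) asz ta.
have pt : p i t != p j t by move: nt; rewrite mem_crossing_seq // t01.
split=> //; rewrite -ct; apply: odd_crossings => //.
- exact: system_path pS i.
- exact: system_path pS j.
- by rewrite sort_uniq fset_uniq.
- by move=> x; rewrite mem_crossing_seq.
- by move=> x /(crossing_seq_itv ij)[].
Qed.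

Lemma crossing_pointP i j t : p i 0 < p j 0 -> 0 <= t <= 1 -> p i t != p j t ->
  exists a, [/\ (a <= size (crossing_seq i j))%N, (p j t < p i t) = odd a &
    crossing_point i j a < t < crossing_point i j a.+1].
Proof.
move=> lt0 t01 pt; have ij : i != j by apply: contraTneq lt0 => ->; rewrite ltxx.
have nt : t \notin crossing_seq i j by rewrite mem_crossing_seq // t01.
have /andP[t0 t1] := t01.
have ta := @count_lt_gap _ 2 _ _ _ (crossing_seq_path ij)
  (lt_le_trans (ltrN10 R) t0) (le_lt_trans t1 (ltr1n R 2)) nt.
exists (count (< t) (crossing_seq i j)); split=> //; first exact: count_size.
by have [] := crossing_point_lt lt0 (count_size _ _) t01 ta.
Qed.

Lemma crossing_point_incr i j a : i != j -> (a <= size (crossing_seq i j))%N ->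
  crossing_point i j a < crossing_point i j a.+1.
Proof.
move=> ij; rewrite leq_eqVlt => /predU1P[->|asz].
  rewrite /crossing_point /= [X in _ < X]nth_default //.
  have : nth 2 (-1 :: crossing_seq i j) (size (crossing_seq i j)) \in -1 :: crossing_seq i j.
    by apply: mem_nth.
  rewrite inE => /predU1P[->|/(crossing_seq_itv ij)[_ /andP[_ h]]]; first by lra.
  by apply: lt_trans h _; rewrite ltr1n.
by have /pathP := crossing_seq_path ij; apply.
Qed.

Lemma crossing_point_mem i j a : i != j -> (0 < a <= size (crossing_seq i j))%N ->
  crossing_point i j a \in crossing_seq i j.
Proof. by case: a => // a ij asz; apply: mem_nth. Qed.

End System.

(** * Homogeneous chains of paths *)

Lemma subseq_nth_drop (T : eqType) (x0 : T) (s u : seq T) k i :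
  (k <= i < size s)%N -> subseq u (drop i.+1 s) -> subseq (nth x0 s i :: u) (drop k s).
Proof.
move=> /andP[ki isz] us; apply: (@subseq_trans _ (drop i s)).
  by rewrite (drop_nth x0 isz) /= eqxx.
by rewrite -(subnK ki) -drop_drop drop_subseq.
Qed.

Lemma subseq_nth3 (T : eqType) (x0 : T) (s : seq T) i j l :
  (i < j)%N -> (j < l < size s)%N -> subseq [:: nth x0 s i; nth x0 s j; nth x0 s l] s.
Proof.
move=> ij /andP[jl ls]; rewrite -{4}[s]drop0.
by do 3 (apply: subseq_nth_drop; first lia); rewrite sub0seq.
Qed.

Section Chain.
Variables (R : realType) (m k N : nat) (p : 'I_m -> R -> R) (i0 : 'I_m) (s : seq 'I_m).
Hypothesis (pS : path_system p) (s_uniq : uniq s) (s_size : size s = N.+1).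
Hypothesis s_sorted : sorted (fun i j => p i 0 <= p j 0) s.

Let q i := nth i0 s i.
Let X i j a := crossing_point p (q i) (q j) a.

Lemma chain_inj i j : (i <= N)%N -> (j <= N)%N -> (q i == q j) = (i == j).
Proof. by move=> iN jN; rewrite nth_uniq // s_size ltnS. Qed.

Lemma chain_lt i j : (i < j <= N)%N -> p (q i) 0 < p (q j) 0.
Proof.
move=> /andP[ij jN]; have iN : (i <= N)%N by lia.
rewrite lt_neqAle; apply/andP; split.
  apply/eqP => /(system_left pS)/eqP; rewrite chain_inj // => /eqP ijE.
  by rewrite ijE ltnn in ij.
have tr : transitive (fun i j => p i 0 <= p j 0) by move=> ? ? ?; apply: le_trans.
by apply: (sorted_ltn_nth tr i0 s_sorted) => //; rewrite inE s_size ltnS.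
Qed.

Lemma chain_neq i j : (i < j <= N)%N -> q i != q j.
Proof. by move=> ij; apply: contraTneq (chain_lt ij) => ->; rewrite ltxx. Qed.

Variable r : nat.
Hypothesis r_size : forall i j, (i < j < N)%N -> size (crossing_seq p (q i) (q j)) = r.
Hypothesis cmp : forall i j l i' j' l' e e' a b,
    (i < j)%N -> (j < l < N)%N -> (i' < j')%N -> (j' < l' < N)%N ->
    (a <= r.+1)%N -> (b <= r.+1)%N ->
    (triangle X i j l e a < triangle X i j l e' b) =
    (triangle X i' j' l' e a < triangle X i' j' l' e' b).

Lemma chain_homogeneous : homogeneous N r X.
Proof.
have le i j : (i < j < N)%N -> (i < j <= N)%N by lia.
have mem i j a : (i < j < N)%N -> (0 < a <= r)%N -> X i j a \in crossing_seq p (q i) (q j).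
  move=> ij ar; apply: crossing_point_mem; first exact: (chain_neq (le _ _ ij)).
  by rewrite r_size.
split=> //.
- move=> i j ij; rewrite /X /crossing_point -(r_size ij) /=.
  exact: nth_default.
- move=> i j a ij ar; apply: (crossing_point_incr pS); rewrite ?r_size //.
  exact: (chain_neq (le _ _ ij)).
- move=> i j a ij ar.
  by have [] := crossing_seq_itv pS (chain_neq (le _ _ ij)) (mem _ _ _ ij ar).
- move=> i j l a b ij jl ar br; have ij' : (i < j < N)%N by lia.
  have il' : (i < l < N)%N by lia.
  have := mem _ _ _ ij' ar; have := mem _ _ _ jl br.
  rewrite !(mem_crossing_seq pS) ?(chain_neq (le _ _ _)) //.
  move=> /andP[_ /eqP e1] /andP[x01 /eqP e2]; apply/eqP => xE.
  case: (@system_triple _ _ _ pS (q i) (q j) (q l) _ _ _ (X i j a)).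
  + exact: chain_neq (le _ _ ij').
  + exact: chain_neq (le _ _ il').
  + exact: chain_neq (le _ _ jl).
  + by rewrite in_itv.
  + by split=> //; rewrite xE.
- move=> i j l a b c t ij jl ar br cr t01 ta tb tc oab.
  have ij' : (i < j < N)%N by lia.
  have il' : (i < l < N)%N by lia.
  have [|nij oij] := crossing_point_lt pS (chain_lt (le _ _ ij')) _ t01 ta.
  + by rewrite r_size.
  have [|njl ojl] := crossing_point_lt pS (chain_lt (le _ _ jl)) _ t01 tb.
  + by rewrite r_size.
  have [|nil oil] := crossing_point_lt pS (chain_lt (le _ _ il')) _ t01 tc.
  + by rewrite r_size.
  rewrite -oil -oij; move: oab; rewrite -oij -ojl.
  case: (ltgtP (p (q j) t) (p (q i) t)) nij => // h _.
    by move/esym/lt_trans/(_ h).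
  case: (ltgtP (p (q l) t) (p (q j) t)) njl => // h' _ _.
  by apply/negbTE; rewrite -leNgt ltW // (lt_trans h h').
Qed.

Lemma chain_component i j t : (i < N)%N -> (j < N)%N -> j != i -> 0 <= t <= 1 ->
  p (q j) t < p (q i) t <-> exists a, component r X i j a t.
Proof.
move=> iN jN ji t01; rewrite /component /points.
case: ltngtP ji => // [ij|ji] _.
  have ijN : (i < j < N)%N by rewrite ij.
  have lt0 : p (q i) 0 < p (q j) 0 by apply: chain_lt; lia.
  split=> [h|[a /and3P[ar /eqP oa ta]]].
    have [|a [ar oa ta]] := crossing_pointP pS lt0 t01; first by rewrite gt_eqF.
    by exists a; rewrite -(r_size ijN) ar -oa h.
  by have [|_ ->] := crossing_point_lt pS lt0 _ t01 ta; rewrite ?r_size ?oa.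
have jiN : (j < i < N)%N by rewrite ji.
have lt0 : p (q j) 0 < p (q i) 0 by apply: chain_lt; lia.
split=> [h|[a /and3P[ar /eqP oa ta]]].
  have [|a [ar oa ta]] := crossing_pointP pS lt0 t01; first by rewrite lt_eqF.
  by exists a; rewrite -(r_size jiN) ar -oa ltNge (ltW h).
have [|n o] := crossing_point_lt pS lt0 _ t01 ta; first by rewrite r_size.
by rewrite lt_neqAle n leNgt o oa.
Qed.

Lemma chain_dominates d : all_subsystems_upper_convex p d.+1 -> dominates N r d X.
Proof.
move=> cv i J iN; rewrite /= => /andP[iJ uJ] /allP JN sJ.
have qinj : {in i :: J &, injective q}.
  have lt x : x \in i :: J -> (x <= N)%N.
    by rewrite inE => /predU1P[->|/JN/ltnW//]; apply: ltnW.
  by move=> x y xJ yJ /eqP; rewrite chain_inj ?lt // => /eqP.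
have uq : uniq (map q (i :: J)) by rewrite (map_inj_in_uniq qinj) /= iJ.
have [||t t01 tP] := cv [set x in map q (i :: J)]%SET _ (q i).
- by rewrite cardsE (card_uniqP uq) size_map /= sJ.
- by rewrite inE mem_head.
exists t; first by rewrite in_itv in t01.
move=> j jJ; apply/chain_component => //; first exact: JN.
- by apply: contraNneq iJ => <-.
apply: tP; first by rewrite inE map_f // inE jJ orbT.
rewrite chain_inj; [|exact: ltnW (JN _ jJ)|exact: ltnW].
by apply: contraNneq iJ => <-.
Qed.

Lemma chain_upper_convex n : (n <= N)%N ->
  (forall i, (i < N)%N -> exists2 t, 0 <= t <= 1 &
     forall j, (j < N)%N -> j != i -> exists a, component r X i j a t) ->
  has_upper_convex_subsystem p n.
Proof.
move=> nN env; have sz : size (take n s) = n by rewrite size_takel // s_size ltnW.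
exists [set x in take n s]%SET; split.
  by rewrite cardsE (card_uniqP (take_uniq _ s_uniq)).
have ind x : x \in take n s -> exists2 i, (i < n)%N & x = q i.
  by move=> /(nthP i0)[i]; rewrite sz => ilt <-; exists i => //; rewrite nth_take.
move=> x; rewrite inE => /ind[i ilt ->].
have [t t01 tP] := env i (leq_trans ilt nN).
exists t; first by rewrite in_itv.
move=> y; rewrite inE => /ind[j jlt ->] ji.
have ji' : j != i by apply: contraNneq ji => ->.
by apply/(chain_component (leq_trans ilt nN) (leq_trans jlt nN) ji' t01);
  apply: tP => //; apply: leq_trans nN.
Qed.

End Chain.

(** * Colouring triples of paths, and the bound *)

Lemma triangle_comp (I J T : Type) (h : J -> I) (Y : I -> I -> T) i j l e :
  triangle (fun i j => Y (h i) (h j)) i j l e = triangle Y (h i) (h j) (h l) e.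
Proof. by case: e => [[|[|e]] he]. Qed.

Lemma upper_convex_bound_exists (R : realType) (k n : nat) :
  exists U, (0 < U)%N /\ upper_convex_bound R k n U.
Proof.
(* A colour records the order of all crossing times of the three pairs, with indices 0 to [k + 1] to
   include both sentinels, and the crossing number of the first pair. *)
pose I := ('I_3 * 'I_k.+2)%type.
pose C := ({ffun I * I -> bool} * 'I_k.+1)%type.
pose N := maxn n 6; have nN : (n <= N)%N := leq_maxl _ _.
have N6 : (6 <= N)%N := leq_maxr _ _.
have [U0 UP] := ramsey C 3 N.+1.
(* The successor only makes the bound positive. *)
exists U0.+1; split=> // m p pS pk /ltnW Um.
pose tri i j l (x : I) := triangle (crossing_point p) i j l x.1 x.2.
pose col (u : seq 'I_m) : C :=
  if u is [:: i; j; l] then ([ffun x => tri i j l x.1 < tri i j l x.2],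
    inord (size (crossing_seq p i j))) else ([ffun=> true], ord0).
pose le0 (i j : 'I_m) := p i 0 <= p j 0.
have i0 : 'I_m := Ordinal (leq_trans (isT : (0 < 3)%N) (system_size pS)).
have [|c [s [ss sz cP]]] := UP _ col (sort le0 (enum 'I_m)).
  by rewrite size_sort size_enum_ord.
have s_uniq : uniq s by rewrite (subseq_uniq ss) // sort_uniq enum_uniq.
have s_sorted : sorted le0 s.
  apply: (subseq_sorted _ ss); first by move=> ? ? ?; apply: le_trans.
  by apply: sort_sorted => ? ?; apply: le_total.
pose q i := nth i0 s i; pose X i j a := crossing_point p (q i) (q j) a.
have colE i j l : (i < j)%N -> (j < l <= N)%N -> col [:: q i; q j; q l] = c.
  by move=> ij jl; apply: cP => //; apply: subseq_nth3; rewrite ?sz.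
have r_size i j : (i < j < N)%N -> size (crossing_seq p (q i) (q j)) = c.2.
  (* The chain has [N + 1] paths: the spare last one completes every pair to a triple, whose colour
     gives the crossing number of the pair. *)
  move=> /andP[ij jN]; rewrite -(colE i j N) ?jN ?leqnn //= inordK // ltnS.
  apply: (size_crossing_seq pS pk); apply: (chain_neq i0 pS s_uniq sz s_sorted).
  by rewrite ij ltnW.
have rk : (c.2 <= k)%N by rewrite -ltnS.
have cmp i j l i' j' l' e e' a b :
    (i < j)%N -> (j < l < N)%N -> (i' < j')%N -> (j' < l' < N)%N ->
    (a <= c.2.+1)%N -> (b <= c.2.+1)%N ->
    (triangle X i j l e a < triangle X i j l e' b) =
    (triangle X i' j' l' e a < triangle X i' j' l' e' b).
  move=> ij jl ij' jl' ar br.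
  have key h h' h'' : (h < h')%N -> (h' < h'' < N)%N ->
      (triangle X h h' h'' e a < triangle X h h' h'' e' b) =
      c.1 ((e, inord a), (e', inord b)).
    move=> hh hh'; rewrite -(colE h h' h'') //; last by lia.
    rewrite /= ffunE /tri /= !inordK ?ltnS; [|lia..].
    by rewrite !(triangle_comp q (crossing_point p)).
  by rewrite !key.
have hX : homogeneous N c.2 X by apply: (chain_homogeneous pS s_uniq sz s_sorted r_size cmp).
have dom d : all_subsystems_upper_convex p d.+1 -> dominates N c.2 d X.
  exact: (chain_dominates pS s_uniq sz s_sorted r_size).
have concl : common_gaps c.2 X -> has_upper_convex_subsystem p n.
  move=> gX; apply: (chain_upper_convex pS s_uniq sz s_sorted r_size nN) => i iN.
  exact: homogeneous_envelope.
split=> kb /dom dX; apply: concl; apply: (common_gapsI N6 hX).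
- by constructor 1; split=> //; apply: leq_trans kb.
- by constructor 2; split=> //; apply: leq_trans kb.
- by constructor 3.
Qed.

Theorem theorem1p5 (R : realType) (k n : nat) (hk : (1 <= k)%N) (hn : (3 <= n)%N) :
  exists U : nat,
    [/\ (0 < U)%N,
        upper_convex_bound R k n U &
        forall V : nat, (0 < V)%N -> upper_convex_bound R k n V -> (U <= V)%N].
Proof.
have ex : exists U, (0 < U)%N && `[< upper_convex_bound R k n U >].
  by have [U [U0 UB]] := upper_convex_bound_exists R k n; exists U; rewrite U0; apply/asboolP.
have [U /andP[U0 /asboolP UB] Umin] := ex_minnP ex.
by exists U; split=> // V V0 VB; apply: Umin; rewrite V0; apply/asboolP.
Qed.
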